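(* Let $\ell$ be an odd prime. The number of non-conjugate subgroups of $\mathrm{GL}_2(\mathbf{Z}/\ell\mathbf{Z})$ (that is, the number of conjugacy classes of subgroups) that lie in a Borel group and contain an element of order $\ell$ is $\alpha(\ell-1)$, the number of subgroups of $C_s(\ell)$.
   Context: For a positive integer $n$, $\alpha(n):=\sum_{a,b\mid n}\gcd(a,b)$, where $a$ and $b$ independently range over the positive divisors of $n$; this is the number of subgroups of $\mathbf{Z}/n\mathbf{Z}\times\mathbf{Z}/n\mathbf{Z}$. Borel groups are the conjugates in $\mathrm{GL}_2(\mathbf{Z}/\ell\mathbf{Z})$ of the subgroup of upper triangular matrices, and $C_s(\ell)$ is the group of invertible diagonal matrices in $\mathrm{GL}_2(\mathbf{Z}/\ell\mathbf{Z})$. *)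

(* Defs.v *)
From HB Require Import structures.
From mathcomp Require Import all_boot all_order all_algebra all_fingroup.

Set Implicit Arguments.
Unset Strict Implicit.
Unset Printing Implicit Defensive.

Import GroupScope.

Definition alpha (n : nat) : nat :=
  (\sum_(a <- divisors n) \sum_(b <- divisors n) gcdn a b)%N.

(* 'GL_2(l) has entries in 'F_l, the ring of integers mod l only when l is prime. *)

(* [is_trig_mx] means lower triangular, hence the transpose. *)
Definition upper_triangular (l : nat) : {set {'GL_2(l)}} :=
  [set g : {'GL_2(l)} | is_trig_mx (GLval g)^T%R].

Definition borel_groups (l : nat) : {set {set {'GL_2(l)}}} :=
  upper_triangular l :^: 'GL_2(l).

Definition Cs (l : nat) : {set {'GL_2(l)}} :=
  [set g : {'GL_2(l)} | is_diag_mx (GLval g)].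

Definition conjugacy_classes (gT : finGroupType) (S : {set {group gT}}) :
    {set {set {set gT}}} :=
  [set (G : {set gT}) :^: [set: gT] | G : {group gT} in S].

Definition borel_subgroups_with_elt_order (l : nat) : {set {group {'GL_2(l)}}} :=
  [set G : {group {'GL_2(l)}} |
    [exists B in borel_groups l, G \subset B]
    && [exists g in G, #[g] == l]].

(* Main.v *)
Require Import Defs.
From HB Require Import structures.
From mathcomp Require Import all_boot all_order all_algebra all_fingroup.
From mathcomp Require Import all_solvable.

Set Implicit Arguments.
Unset Strict Implicit.
Unset Printing Implicit Defensive.

Import GroupScope.

(** Let B be the upper triangular group, U its unipotent subgroup, of order l,
    and T the diagonal torus, so that B = U ><| T and T is abelian of order
    (l - 1) ^ 2, prime to l.

    Both halves of the statement count the subgroups of T. A subgroup G of B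
    with an element of order l contains U, because U is the only subgroup of
    order l of B; hence G = U (G :&: T), and H |-> U H is a bijection from the
    subgroups of T to the groups G. Two such groups that are conjugate in the
    whole linear group are equal: an element that conjugates one into the other
    must normalise U, hence lies in 'N(U) = B, and every group between U and B
    is normal in B since B / U is abelian ([card_classes_order_p]).

    As T is the product of two cyclic groups of order l - 1, there remains to
    count the subgroups H of C \x D with C and D cyclic
    ([card_subgroups_cyclic_dprod]). In the spirit of Goursat's lemma, H is
    determined by K = H :&: C, by its projection P = <[z]> to D, and by the
    coset of K formed by the u in C with z u in H. The cosets that occur are
    those with u ^+ #[z] in K, and there are gcd(#|C : K|, #|P|) of them.
    Summing over K and P gives the sum of the gcds of all pairs of divisors. *)

(** * Divisors and subgroups of cyclic groups *)

(** The t with c dividing t b are the multiples of c / gcd(c, b). This is the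
    number of solutions t mod c of (x ^+ t) ^+ b \in <[x ^+ c]>. *)
Lemma card_ord_dvdn_mul (c b : nat) :
  0 < c -> #|[set t : 'I_c | c %| t * b]| = gcdn c b.
Proof.
move=> c_gt0; set g := gcdn c b; have g_gt0 : 0 < g by rewrite gcdn_gt0 c_gt0.
have [gc gb] : g %| c /\ g %| b by rewrite dvdn_gcdl dvdn_gcdr.
have e_gt0 : 0 < c %/ g by rewrite divn_gt0 // dvdn_leq.
have dvdE t : (c %| t * b) = (c %/ g %| t).
  rewrite -[X in X %| _](divnK gc) -[X in _ %| (_ * X)%N](divnK gb).
  rewrite mulnA dvdn_pmul2r //.
  rewrite Gauss_dvdl // /coprime -(eqn_pmul2r g_gt0) mul1n.
  by rewrite muln_gcdl !divnK.
have lt_mul (i : 'I_g) : i * (c %/ g) < c.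
  by rewrite -{2}(divnK gc) mulnC ltn_pmul2l.
pose mul_ord i := Ordinal (lt_mul i).
rewrite -[RHS]card_ord -cardsT -(card_imset _ (_ : injective mul_ord)).
  apply: eq_card => t; rewrite inE dvdE;
  apply/idP/imsetP => [/dvdnP[i def_t] | [i _ ->]].
    have lt_ig : i < g.
      by rewrite -(ltn_pmul2r e_gt0) -def_t (mulnC g) divnK.
    by exists (Ordinal lt_ig) => //; apply: val_inj.
  exact: dvdn_mull.
move=> i j /(congr1 val) /= /eqP; rewrite eqn_pmul2r // => /eqP; exact: val_inj.
Qed.

Lemma perm_divisors_codivisors n :
  0 < n -> perm_eq (divisors n) [seq n %/ d | d <- divisors n].
Proof.
move=> n_gt0; have divE d : (d \in divisors n) = (d %| n) by rewrite -dvdn_divisors.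
have codivK d : d %| n -> (n %/ (n %/ d) = d)%N by move=> dn; rewrite divnA ?mulKn.
apply: uniq_perm; rewrite ?divisors_uniq //.
  rewrite map_inj_in_uniq ?divisors_uniq // => a b; rewrite !divE => an bn eq_ab.
  by rewrite -(codivK a) // eq_ab codivK.
move=> d; apply/idP/mapP => [|[a]]; rewrite !divE; last first.
  by move=> an ->; exact: dvdn_div.
by move=> dn; exists (n %/ d); rewrite ?divE ?dvdn_div ?codivK.
Qed.

Lemma mem_cycle_expg (gT : finGroupType) (x : gT) c i :
  c %| #[x] -> (x ^+ i \in <[x ^+ c]>) = (c %| i).
Proof.
move=> cx; apply/cycleP/idP => [[k] | /dvdnP[k ->]]; last first.
  by exists k; rewrite mulnC expgM.
move/eqP; rewrite -expgM eq_expg_mod_order => /eqP/(congr1 (modn^~ c)).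
by rewrite !modn_dvdm // modnMr => /eqP.
Qed.

(** A finite cyclic group has exactly one subgroup of each index. *)
Lemma sum_subgroups_cycle (gT : finGroupType) (x : gT) (F : {group gT} -> nat) :
  (\sum_(K in subgroups <[x]>) F K = \sum_(d <- divisors #[x]) F <[x ^+ d]>%G)%N.
Proof.
have divE d : (d \in divisors #[x]) = (d %| #[x]) by rewrite -dvdn_divisors.
rewrite -(big_map (fun d => <[x ^+ d]>%G) xpredT) -big_filter.
apply: perm_big; apply: uniq_perm; rewrite ?filter_uniq ?index_enum_uniq //.
  rewrite map_inj_in_uniq ?divisors_uniq // => a b; rewrite !divE => ax bx.
  move/(congr1 (@gval gT)) => /= eq_ab; apply/eqP.
  rewrite eqn_dvd -(mem_cycle_expg _ ax) -(mem_cycle_expg _ bx).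
  by rewrite -eq_ab cycle_id eq_ab cycle_id.
move=> K; rewrite mem_filter mem_index_enum andbT inE.
apply/idP/mapP => [sKx | [d _ ->]]; last exact: cycleX.
have Kx : #|K| %| #[x] by rewrite cardSg.
exists (#[x] %/ #|K|)%N; first by rewrite divE dvdn_div.
by apply/eqP; rewrite -in_set1 -cycle_sub_group // inE sKx eqxx.
Qed.

(** * Subgroups of a direct product *)

Section DirectProductSubgroups.

Variables (gT : finGroupType) (A B G : {group gT}).
Hypothesis defG : A \x B = G.

Let cAB : A \subset 'C(B). Proof. by case/dprodP: defG; rewrite centsC. Qed.
Let tiAB : A :&: B = 1. Proof. by case/dprodP: defG. Qed.
Let mulAB : A * B = G. Proof. by case/dprodP: defG. Qed.

(** The projection of H to B along A, as a subset of the ambient group. *)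
Definition dproj (H : {set gT}) := (A * H) :&: B.

(** Existence half of Goursat's description, for a cyclic projection. The
    condition on u is what keeps the intersection with A from growing: a power
    (z u) ^+ k lies in A only if #[z] divides k. *)
Lemma dproj_extension (K : {group gT}) (z u : gT) :
    abelian A -> K \subset A -> z \in B -> u \in A -> u ^+ #[z] \in K ->
  (K <*> <[z * u]>) :&: A = K
    /\ dproj (K <*> <[z * u]>) = <[z]>.
Proof.
move=> cAA sKA Bz Au Kuz.
have czu : commute z u by apply: commute_sym; exact: (centsP cAB).
have cKw : <[z * u]> \subset 'C(K).
  rewrite cycle_subG groupM //; last first.
    exact: subsetP (subset_trans cAA (centS sKA)) _ Au.
  by apply: (subsetP _ _ Bz); rewrite centsC (subset_trans sKA).
rewrite /dproj cent_joinEr //; split.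
  rewrite -group_modl //; apply: mulGSid; apply/subsetP=> w /setIP[/cycleP[k ->]].
  rewrite expgMn // (groupMr _ (groupX k Au)) => Azk.
  have zk1 : z ^+ k = 1 by apply/set1gP; rewrite -tiAB inE Azk groupX /=.
  have /dvdnP[j ->]: #[z] %| k by rewrite order_dvdn zk1 eqxx.
  by rewrite mulnC !expgM expg_order expg1n mul1g groupX.
(* Modulo A, the generators z * u and z are the same. *)
have mulAw : A * <[z * u]> = A * <[z]>.
  have cAz : <[z]> \subset 'C(A) by rewrite cycle_subG (subsetP _ _ Bz) // centsC.
  have cAw : <[z * u]> \subset 'C(A).
    by rewrite cycle_subG groupM ?(subsetP cAA _ Au) // -cycle_subG.
  rewrite -!cent_joinEr //; apply/eqP; rewrite eqEsubset !join_subG !joing_subl.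
  have Ju w : u \in A <*> <[w]> by rewrite mem_gen // inE Au.
  have Jw w : w \in A <*> <[w]> by rewrite mem_gen // inE cycle_id orbT.
  by rewrite !cycle_subG groupM //= -(groupMr _ (Ju _)) Jw.
rewrite mulgA (mulGSid sKA) // mulAw setIC -group_modr ?cycle_subG //.
by rewrite setIC tiAB mul1g.
Qed.

(** Uniqueness half: any lift z u of a generator z of the projection generates H
    over H :&: A, since it can be used to cancel the B-component of any element
    of H. *)
Lemma dproj_decomposition (H : {group gT}) (z : gT) :
    H \subset G -> dproj H = <[z]> ->
  exists2 u, u \in A
    & u ^+ #[z] \in H /\ H = ((H :&: A) <*> <[z * u]>)%G.
Proof.
move=> sHG trH.
have : z \in dproj H by rewrite trH cycle_id.
case/setIP=> /mulsgP[a h Aa Hh def_z] Bz.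
have czA v : v \in A -> commute z v.
  by move=> Av; apply: commute_sym; apply: (centsP cAB).
have Hza : z * a^-1 \in H by rewrite czA ?groupV // def_z mulKg.
exists a^-1; rewrite ?groupV //; split.
  have := groupX #[z] Hza; rewrite expgMn ?expg_order ?mul1g //.
  by apply: czA; rewrite groupV.
apply/val_inj/eqP; rewrite eqEsubset join_subG subsetIl cycle_subG Hza !andbT.
apply/subsetP=> h1 Hh1.
have : h1 \in A * B by rewrite mulAB (subsetP sHG).
case/mulsgP=> a1 b1 Aa1 Bb1 def_h1.
have : b1 \in dproj H.
  by rewrite inE Bb1 andbT -(mulKg a1 b1) -def_h1 mem_mulg ?groupV.
rewrite trH => /cycleP[k def_b1].
(* h1 and (z * a^-1) ^+ k have the same B-component, so they differ by an
   element of H :&: A. *)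
rewrite -(mulgKV ((z * a^-1) ^+ k) h1) groupM //; last first.
  by rewrite groupX // mem_gen // inE cycle_id orbT.
rewrite mem_gen // inE; apply/orP; left; rewrite inE groupM ?groupV ?groupX //=.
rewrite def_h1 def_b1 expgMn; last by apply: czA; rewrite groupV.
have Aak : a^-1 ^+ k \in A by rewrite groupX // groupV.
have -> : z ^+ k * a^-1 ^+ k = a^-1 ^+ k * z ^+ k.
  by apply/esym/commuteX/commute_sym/czA.
by rewrite invMg mulgA mulgK groupM ?groupV.
Qed.

End DirectProductSubgroups.

(** * Subgroups of a product of two cyclic groups *)

Section CyclicByCyclic.

Variables (gT : finGroupType) (x y : gT) (G : {group gT}).
Hypothesis defG : <[x]> \x <[y]> = G.

(** The groups in question are <[x ^+ c]> <*> <[z * x ^+ t]>, where t matters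
    only modulo c and must satisfy c %| t * #[z]. *)
Lemma card_dproj_fibre c z :
    c %| #[x] -> z \in <[y]> ->
  #|[set H in subgroups G | (H :&: <[x]> == <[x ^+ c]>)
       && (dproj <[x]> <[y]> H == <[z]>)]| = gcdn c #[z].
Proof.
move=> cx yz; have c_gt0 : 0 < c by exact: dvdn_gt0 cx.
have [cAA xX] := (cycle_abelian x, mem_cycle x).
have sKA : <[x ^+ c]> \subset <[x]> by exact: cycleX.
have trK := dproj_extension defG cAA sKA yz (xX _).
rewrite -(card_ord_dvdn_mul #[z] c_gt0).
pose ext (t : 'I_c) := (<[x ^+ c]> <*> <[z * x ^+ t]>)%G.
have valid (t : 'I_c) : c %| t * #[z] -> (x ^+ t) ^+ #[z] \in <[x ^+ c]>.
  by rewrite -expgM mem_cycle_expg.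
rewrite -(card_in_imset (_ : {in [set t : 'I_c | c %| t * #[z]] &, injective ext})).
  apply: eq_card => H; rewrite !inE; apply/and3P/imsetP.
    case=> sHG /eqP trA /eqP trB.
    have [u /cycleP[i ->] [Hu defH]] := dproj_decomposition defG sHG trB.
    (* Reduce the exponent modulo c: x ^+ (i %/ c * c) lies in H :&: <[x]>. *)
    have ltic : i %% c < c by rewrite ltn_mod.
    have mod_i : x ^+ (i %/ c * c) \in <[x ^+ c]>.
      by rewrite mem_cycle_expg ?dvdn_mull.
    exists (Ordinal ltic).
      rewrite inE /= -(mem_cycle_expg _ cx) -trA inE mem_cycle andbT.
      have Hc : x ^+ (i %/ c * c) \in H.
        by move: mod_i; rewrite -trA => /setIP[].
      move: Hu; rewrite -expgM {1}(divn_eq i c) mulnDl expgD groupMl //.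
      by rewrite expgM groupX.
    rewrite defH; apply: val_inj; rewrite /= trA {1}(divn_eq i c) expgD.
    apply/eqP; rewrite eqEsubset !join_subG !joing_subl !cycle_subG /=.
    set k := x ^+ (i %/ c * c) in mod_i *.
    have -> : z * (k * x ^+ (i %% c)) = k * (z * x ^+ (i %% c)).
      have /(centsP) cxy : <[x]> \subset 'C(<[y]>).
        by case/dprodP: defG; rewrite centsC.
      by rewrite !mulgA (cxy k) ?mem_cycle.
    have Jk w : k \in <[x ^+ c]> <*> <[w]> by rewrite mem_gen // inE mod_i.
    have Jw w : w \in <[x ^+ c]> <*> <[w]> by rewrite mem_gen // inE cycle_id orbT.
    by rewrite groupM //= -(groupMl _ (Jk _)) Jw.
  case=> t; rewrite inE => ct ->; have [-> ->] := trK _ (valid t ct).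
  split=> //; case/dprodP: defG => _ <- cBA _.
  rewrite -cent_joinEr // join_subG (subset_trans sKA) ?joing_subl //=.
  by rewrite cycle_subG groupM ?mem_gen ?inE ?yz ?mem_cycle ?orbT.
move=> t1 t2; rewrite !inE => ct1 ct2 eq12; apply: val_inj => /=.
(* If t1 <= t2 give the same group, x ^+ (t2 - t1) lies in its intersection with
   <[x]>, so c divides t2 - t1 < c. *)
have [tr1 _] := trK _ (valid t1 ct1).
have in1 : z * x ^+ t1 \in ext t1 by rewrite mem_gen // inE cycle_id orbT.
have in2 : z * x ^+ t2 \in ext t1 by rewrite eq12 mem_gen // inE cycle_id orbT.
have lt12 (s1 s2 : 'I_c) : z * x ^+ s1 \in ext t1 -> z * x ^+ s2 \in ext t1 ->
    s1 <= s2 -> s1 = s2 :> nat.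
  move=> in1' in2' le12; apply/eqP; rewrite eqn_leq le12 -subn_eq0 /=.
  have: x ^+ (s2 - s1) \in <[x ^+ c]>.
    rewrite -tr1 inE mem_cycle andbT -(groupMl _ in1') -mulgA -expgD.
    by rewrite subnKC.
  rewrite mem_cycle_expg // => /dvdn_leq; case: posnP => [-> // | _ /(_ isT)].
  by rewrite leqNgt (leq_ltn_trans (leq_subr _ _)).
by case/orP: (leq_total t1 t2) => [/lt12-> // | /lt12 ->].
Qed.

Theorem card_subgroups_cyclic_dprod :
  (#|subgroups G|
     = \sum_(a <- divisors #[x]) \sum_(b <- divisors #[y]) gcdn a b)%N.
Proof.
pose trA (H : {group gT}) := (H :&: <[x]>)%G.
have trB_group (H : {group gT}) : H \subset G ->
    dproj <[x]> <[y]> H = (<[x]> <*> H) :&: <[y]>.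
  move=> sHG; rewrite /dproj norm_joinEr //.
  apply: subset_trans sHG _; case/dprodP: defG => _ <- cBA _.
  by rewrite -cent_joinEr // join_subG normG cents_norm.
pose trB (H : {group gT}) := ((<[x]> <*> H) :&: <[y]>)%G.
rewrite -sum1_card (partition_big trA (mem (subgroups <[x]>))); last first.
  by move=> H _; rewrite /= inE /= subsetIr.
rewrite (eq_bigr (fun K => \sum_(P in subgroups <[y]>)
  \sum_(H in subgroups G | (trA H == K) && (trB H == P)) 1)%N); last first.
  move=> K _; rewrite (partition_big trB (mem (subgroups <[y]>))).
    by apply: eq_bigr => P _; apply: eq_bigl => H; rewrite andbA.
  by move=> H _; rewrite /= inE /= subsetIr.
rewrite sum_subgroups_cycle !big_seq; apply: eq_bigr => c.
rewrite -dvdn_divisors // => cx.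
(* On the y side, <[y ^+ d]> has order #[y] %/ d, so the sum is reindexed by
   the codivisors. *)
rewrite sum_subgroups_cycle.
rewrite [RHS](perm_big _ (perm_divisors_codivisors (order_gt0 y))).
rewrite big_map !big_seq; apply: eq_bigr => d; rewrite -dvdn_divisors // => dy.
rewrite -orderXdiv // -card_dproj_fibre ?mem_cycle // -sum1_card.
apply: eq_bigl => H; rewrite [RHS]inE; apply: andb_id2l; rewrite inE => sHG.
by rewrite trB_group.
Qed.

End CyclicByCyclic.

(** * Conjugacy classes of subgroups over a normal Sylow subgroup *)

Section NormalSylowClasses.

Variables (gT : finGroupType) (p : nat) (U T B : {group gT}).
Hypotheses (p_pr : prime p) (defB : U ><| T = B) (cardU : #|U| = p).
Hypotheses (p'T : p^'.-group T) (cTT : abelian T) (sNUB : 'N(U) \subset B).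

Let nsUB : U <| B. Proof. by case/sdprod_context: defB. Qed.

Let sylU : p.-Sylow(B) U.
Proof.
rewrite pHallE normal_sub // -(sdprod_card defB) cardU.
by rewrite (partnM _ (prime_gt0 p_pr)) // part_pnat_id ?pnat_id //
           part_p'nat // muln1 eqxx.
Qed.

Lemma sub_pgroup_normal_Sylow (P : {group gT}) :
  P \subset B -> #|P| = p -> P :=: U.
Proof.
move=> sPB cardP; apply/eqP; rewrite eqEcard cardU cardP leqnn andbT.
by rewrite (sub_normal_Hall sylU) // /pgroup cardP pnat_id.
Qed.

(** B / U is isomorphic to T, hence abelian, so U contains the derived subgroup
    of B. *)
Lemma normal_join_kernel (H : {group gT}) : H \subset T -> U <*> H <| B.
Proof.
move=> sHT; have [_ mulUT nUT _] := sdprodP defB.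
have sB'U : B^`(1) \subset U.
  rewrite der1_min ?normal_norm //.
  by rewrite -(isog_abelian (sdprod_isog defB)).
apply: sub_der1_normal; first exact: subset_trans sB'U (joing_subl _ _).
by rewrite join_subG normal_sub //= -mulUT (subset_trans sHT) // mulG_subr.
Qed.

Lemma join_kernelK (H : {group gT}) : H \subset T -> (U <*> H) :&: T = H.
Proof.
move=> sHT; have [_ mulUT nUT tiUT] := sdprodP defB.
by rewrite norm_joinEr ?(subset_trans sHT) // setIC -group_modr // setIC tiUT mul1g.
Qed.

Lemma kernel_joinK (G : {group gT}) :
  U \subset G -> G \subset B -> U <*> (G :&: T) = G.
Proof.
move=> sUG sGB; have [_ mulUT nUT _] := sdprodP defB.
rewrite norm_joinEr; last by rewrite subIset // nUT orbT.
by rewrite /= setIC group_modl // mulUT; apply/setIidPr.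
Qed.

(** H |-> U <*> H maps the subgroups of T onto the relevant conjugacy classes.
    It is injective on classes because fusion between groups containing U is
    controlled by 'N(U), which is contained in B and normalises them all. *)
Theorem card_classes_order_p :
  #|conjugacy_classes [set G : {group gT} |
      [exists C in (B : {set gT}) :^: [set: gT], G \subset C]
      && [exists g in G, #[g] == p]]|
    = #|subgroups T|.
Proof.
pose cls (H : {group gT}) := (U <*> H) :^: [set: gT].
rewrite -(card_in_imset (_ : {in subgroups T &, injective cls})); last first.
  move=> H1 H2; rewrite !inE => sH1 sH2 eq12; apply: val_inj => /=.
  have : U <*> H2 \in cls H1.
    by rewrite eq12; apply/imsetP; exists 1; rewrite ?inE ?conjsg1.
  case/imsetP=> z _ defH2.
  have Uz : (U :^ z)%G :=: U.
    apply: sub_pgroup_normal_Sylow; last by rewrite /= cardJg.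
    apply: subset_trans (normal_sub (normal_join_kernel sH2)).
    by rewrite defH2 conjSg joing_subl.
  have Bz : z \in B by apply: (subsetP sNUB); apply/normP.
  rewrite -(join_kernelK sH1) -(join_kernelK sH2) defH2.
  by rewrite (normsP (normal_norm (normal_join_kernel sH1)) z Bz).
apply: eq_card => X; apply/imsetP/imsetP => [[G] | [H]]; rewrite !inE.
  case/andP=> /exists_inP[_ /imsetP[z _ ->] sGBz] /exists_inP[g Gg /eqP og] ->.
  pose G1 := (G :^ z^-1)%G.
  have sG1B : G1 \subset B by rewrite sub_conjgV.
  have sUG1 : U \subset G1.
    have og1 : #|<[g ^ z^-1]>%G| = p by rewrite /= -orderE orderJ.
    rewrite -(sub_pgroup_normal_Sylow _ og1) cycle_subG /= ?memJ_conjg //.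
    by rewrite (subsetP sG1B) //= memJ_conjg.
  exists (G1 :&: T)%G; first by rewrite inE subsetIr.
  by rewrite /cls /= (kernel_joinK sUG1 sG1B) /= conjugates_conj lcoset_id // inE.
move=> sHT ->; exists (U <*> H)%G => //; rewrite inE; apply/andP; split.
  apply/exists_inP; exists (B : {set gT}).
    by apply/imsetP; exists 1; rewrite ?inE ?conjsg1.
  exact: normal_sub (normal_join_kernel sHT).
have : prime #|U| by rewrite cardU.
case/prime_cyclic/cyclicP=> u defU; apply/exists_inP; exists u.
  by rewrite (subsetP (joing_subl _ _)) // defU cycle_id.
by rewrite orderE -defU cardU.
Qed.

End NormalSylowClasses.

(** * Triangular matrices of size 2 *)

Section Triangular.

Variable F : finFieldType.

(* The matrices are taken in {unit 'M[F]_2} rather than in the convertible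
   {'GL_2[F]}: the finite type and the group structures of the latter come from
   different instances, whose unification is very slow. *)
Notation GL2 := {unit 'M[F]_2}.

Definition upper_GL2 : {set GL2} := [set g : GL2 | is_trig_mx (val g)^T%R].
Definition diag_GL2 : {set GL2} := [set g : GL2 | is_diag_mx (val g)].

(** Written with 1 x 1 blocks, so that products, transposes and determinants
    come from the block matrix lemmas. *)
Definition triang_mx (a d b : F) : 'M[F]_(1 + 1) :=
  block_mx a%:M b%:M 0%R d%:M.

Lemma triang_mx_unit (a d : {unit F}) b : triang_mx (val a) (val d) b \in unitmx.
Proof.
by rewrite unitmxE det_ublock !det_scalar1 GRing.unitrM !(valP a) (valP d).
Qed.

Definition triang (a d : {unit F}) (b : F) : GL2 :=
  FinRing.Unit (triang_mx_unit a d b).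

Lemma triangM a d b a' d' b' :
  triang a d b * triang a' d' b'
    = triang (a * a') (d * d') (val a * b' + b * val d')%R.
Proof.
apply: val_inj; rewrite /= -[LHS]/(mulmx (triang_mx _ _ _) (triang_mx _ _ _)).
rewrite (@mulmx_block _ 1 1 1 1 1 1) !mul0mx !mulmx0 !GRing.addr0 !GRing.add0r.
by rewrite -!scalar_mxM -(GRing.raddfD (@scalar_mx F 1)).
Qed.

Lemma mx2_blockE (M : 'M[F]_(1 + 1)) :
  exists a b c d : F, M = block_mx a%:M b%:M c%:M d%:M.
Proof.
exists (ulsubmx M 0 0)%R, (ursubmx M 0 0)%R, (dlsubmx M 0 0)%R, (drsubmx M 0 0)%R.
by rewrite -!mx11_scalar submxK.
Qed.

Lemma scalar_mx1_inj : injective (fun a : F => a%:M%R : 'M_1).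
Proof. by move=> a b /matrixP/(_ 0%R 0%R); rewrite !mxE eqxx. Qed.

Lemma triang_inj a d b a' d' b' :
  triang a d b = triang a' d' b' -> [/\ a = a', d = d' & b = b'].
Proof.
move/(congr1 val); rewrite /= => /(@eq_block_mx _ 1 1 1 1)[].
by move=> /scalar_mx1_inj/val_inj-> /scalar_mx1_inj-> _ /scalar_mx1_inj/val_inj->.
Qed.

Lemma triang1 : 1 = triang 1 1 0%R.
Proof. by apply: val_inj; rewrite /= /triang_mx GRing.raddf0 -scalar_mx_block. Qed.

Lemma triangX a d n : triang a d 0%R ^+ n = triang (a ^+ n) (d ^+ n) 0%R.
Proof.
elim: n => [|n IHn]; first exact: triang1.
by rewrite !expgS IHn triangM GRing.mulr0 GRing.mul0r GRing.addr0.
Qed.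

Lemma triang_surj (g : GL2) (a d b : F) :
  val g = triang_mx a d b -> exists a' d', g = triang a' d' b.
Proof.
move=> defg; have: val g \in unitmx by exact: valP.
rewrite defg unitmxE /triang_mx (@det_ublock _ 1 1) !det_scalar1.
rewrite GRing.unitrM => /andP[Ua Ud].
by exists (FinRing.Unit Ua), (FinRing.Unit Ud); apply: val_inj; rewrite /= defg.
Qed.

Lemma upper_GL2P (g : GL2) :
  reflect (exists a d b, g = triang a d b) (g \in upper_GL2).
Proof.
rewrite inE; apply: (iffP idP) => [|[a [d [b ->]]]]; last first.
  rewrite /= (@tr_block_mx _ 1 1 1 1) (@is_trig_block_mx _ 1 1 1 1) //.
  by rewrite trmx0 eqxx !mx11_is_trig.
have [a [b [c [d defg]]]] := mx2_blockE (val g).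
rewrite defg (@tr_block_mx _ 1 1 1 1) (@is_trig_block_mx _ 1 1 1 1) //.
case/and3P; rewrite trmx_eq0 => /eqP c0 _ _; rewrite c0 in defg.
by have [a' [d' ->]] := triang_surj defg; exists a', d', b.
Qed.

Lemma diag_GL2P (g : GL2) :
  reflect (exists a d, g = triang a d 0%R) (g \in diag_GL2).
Proof.
rewrite inE; apply: (iffP idP) => [|[a [d ->]]]; last first.
  by rewrite /= (@is_diag_block_mx _ 1 1 1 1) // GRing.raddf0 eqxx !mx11_is_diag.
have [a [b [c [d defg]]]] := mx2_blockE (val g).
rewrite defg (@is_diag_block_mx _ 1 1 1 1) //.
case/and4P=> /eqP b0 /eqP c0 _ _; apply: (@triang_surj _ a d).
by rewrite defg b0 c0 /triang_mx GRing.raddf0.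
Qed.

Lemma upper_GL2_group_set : group_set upper_GL2.
Proof.
apply/group_setP; split=> [|g h].
  by apply/upper_GL2P; exists 1, 1, 0%R; exact: triang1.
move=> /upper_GL2P[a [d [b ->]]] /upper_GL2P[a' [d' [b' ->]]].
by rewrite triangM; apply/upper_GL2P; do 3!eexists.
Qed.
Canonical upper_GL2_group := Group upper_GL2_group_set.

Lemma diag_GL2_group_set : group_set diag_GL2.
Proof.
apply/group_setP; split=> [|g h].
  by apply/diag_GL2P; exists 1, 1; exact: triang1.
move=> /diag_GL2P[a [d ->]] /diag_GL2P[a' [d' ->]].
rewrite triangM GRing.mulr0 GRing.mul0r GRing.addr0.
by apply/diag_GL2P; do 2!eexists.
Qed.
Canonical diag_GL2_group := Group diag_GL2_group_set.

Definition unipotent : {set GL2} := [set triang 1 1 b | b : F].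

Lemma unipotent_group_set : group_set unipotent.
Proof.
apply/group_setP; split=> [|g h].
  by apply/imsetP; exists 0%R; rewrite // triang1.
move=> /imsetP[b _ ->] /imsetP[b' _ ->].
by rewrite triangM !mulg1; apply/imsetP; eexists.
Qed.
Canonical unipotent_group := Group unipotent_group_set.

Lemma card_unipotent : #|unipotent| = #|F|.
Proof. by rewrite card_imset // => b b' /triang_inj[]. Qed.

Lemma upper_GL2_sdprod : unipotent ><| diag_GL2 = upper_GL2.
Proof.
rewrite sdprodE.
- apply/setP=> g; apply/mulsgP/upper_GL2P => [[u t] | [a [d [b ->]]]].
    move=> /imsetP[b _ ->] /diag_GL2P[a [d ->]] ->.
    by rewrite triangM; do 3!eexists.
  (* [[a, b], [0, d]] = [[1, b / d], [0, 1]] * diag(a, d). *)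
  exists (triang 1 1 (b / FinRing.uval d)%R) (triang a d 0%R).
  - by apply/imsetP; eexists.
  - by apply/diag_GL2P; do 2!eexists.
  rewrite triangM !mul1g GRing.mulr0 GRing.add0r GRing.divrK //.
  exact: (valP d).
- apply/subsetP=> t /diag_GL2P[a [d ->]]; rewrite inE.
  apply/subsetP=> _ /imsetP[_ /imsetP[b _ ->] ->].
  (* diag(a, d) conjugates the entry b to b d / a. *)
  apply/imsetP; exists ((FinRing.uval a)^-1 * (b * FinRing.uval d))%R => //.
  apply: (mulgI (triang a d 0%R)); rewrite -conjgC !triangM !mul1g !mulg1.
  rewrite !GRing.mul0r !GRing.mulr0 !GRing.addr0 !GRing.add0r GRing.mulVKr //.
  exact: (valP a).
apply/trivgP/subsetP=> g /setIP[/imsetP[b _ ->] /diag_GL2P[a [d eq_diag]]].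
have [_ _ ->] := triang_inj eq_diag.
by rewrite -triang1; apply: set11.
Qed.

(** If g conjugates the transvection with entry 1 into the unipotent group,
    comparing the top left entries of u g = g u' gives g11 + g21 = g11, so
    g21 = 0. *)
Lemma norm_unipotent : 'N(unipotent) \subset upper_GL2.
Proof.
apply/subsetP=> g /normP Ng; rewrite inE.
have: triang 1 1 1%R ^ g \in unipotent.
  by rewrite -Ng memJ_conjg; apply: imset_f.
case/imsetP=> b' _ /(congr1 (mulg g)); rewrite -conjgC => /(congr1 val).
have [a [b [c [d defg]]]] := mx2_blockE (val g).
rewrite /= defg => /(etrans (esym (@mulmx_block _ 1 1 1 1 1 1 _ _ _ _ _ _ _ _))).
move/esym/(etrans (esym (@mulmx_block _ 1 1 1 1 1 1 _ _ _ _ _ _ _ _)))/esym.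
case/(@eq_block_mx _ 1 1 1 1) => eqa _ _ _.
move: eqa; rewrite !mul1mx mulmx1 mulmx0 GRing.addr0 => /eqP.
rewrite -GRing.subr_eq0 GRing.addrAC GRing.subrr GRing.add0r => /eqP c0.
rewrite c0 (@tr_block_mx _ 1 1 1 1) (@is_trig_block_mx _ 1 1 1 1) //.
by rewrite trmx0 eqxx !mx11_is_trig.
Qed.

(** The two coordinate embeddings of F^* give the decomposition. *)
Lemma diag_GL2_dprod (u : {unit F}) : <[u]> = [set: {unit F}] ->
  <[triang u 1 0%R]> \x <[triang 1 u 0%R]> = diag_GL2.
Proof.
move=> gen_u; have powu a : {i | a = u ^+ i}.
  have /cyclePmin[i _ ->] : a \in <[u]> by rewrite gen_u inE.
  by exists i.
rewrite dprodE.
- apply/setP=> g; apply/mulsgP/diag_GL2P => [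
    [_ _ /cycleP[i ->] /cycleP[j ->] ->] | [a [d ->]]].
    rewrite !triangX triangM GRing.mulr0 GRing.mul0r GRing.addr0.
    by do 2!eexists.
  have [[i ->] [j ->]] := (powu a, powu d).
  exists (triang u 1 0%R ^+ i) (triang 1 u 0%R ^+ j); rewrite ?mem_cycle //.
  rewrite !triangX triangM GRing.mulr0 GRing.mul0r GRing.addr0.
  by rewrite !expg1n mul1g mulg1.
- apply: cents_cycle; rewrite /commute !triangM.
  by rewrite !GRing.mulr0 !GRing.mul0r !mulg1 !mul1g.
apply/trivgP/subsetP=> g /setIP[/cycleP[i ->] /cycleP[j]].
rewrite !triangX !expg1n => /triang_inj[-> _ _].
by rewrite -triang1; apply: set11.
Qed.

Lemma order_triangl u : #[triang u 1 0%R] = #[u].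
Proof.
have ord n : (triang u 1 0%R ^+ n == 1) = (u ^+ n == 1).
  rewrite triangX expg1n triang1; apply/eqP/eqP => [/triang_inj[] // | -> //].
by apply/eqP; rewrite eqn_dvd !order_dvdn ord -[X in _ && X]ord !expg_order !eqxx.
Qed.

Lemma order_triangr u : #[triang 1 u 0%R] = #[u].
Proof.
have ord n : (triang 1 u 0%R ^+ n == 1) = (u ^+ n == 1).
  rewrite triangX expg1n triang1; apply/eqP/eqP => [/triang_inj[] // | -> //].
by apply/eqP; rewrite eqn_dvd !order_dvdn ord -[X in _ && X]ord !expg_order !eqxx.
Qed.

Let unit_generator : exists u, [set: {unit F}] = <[u]>.
Proof. exact/cyclicP/field_unit_group_cyclic. Qed.

Lemma abelian_diag_GL2 : abelian diag_GL2.
Proof.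
have [u gen_u] := unit_generator.
have /dprodP[_ <- cyx _] := diag_GL2_dprod (esym gen_u).
by rewrite abelianM !cycle_abelian.
Qed.

Lemma card_diag_GL2 : #|diag_GL2| = (#|F|.-1 ^ 2)%N.
Proof.
have [u gen_u] := unit_generator.
rewrite -(dprod_card (diag_GL2_dprod (esym gen_u))) -!orderE.
by rewrite order_triangl order_triangr orderE -gen_u card_finField_unit.
Qed.

Lemma card_subgroups_diag_GL2 : #|subgroups diag_GL2| = alpha #|F|.-1.
Proof.
have [u gen_u] := unit_generator.
rewrite (card_subgroups_cyclic_dprod (diag_GL2_dprod (esym gen_u))).
by rewrite order_triangl order_triangr orderE -gen_u card_finField_unit.
Qed.

Lemma card_upper_GL2_classes : prime #|F| ->
  #|conjugacy_classes [set G : {group GL2} |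
      [exists C in upper_GL2 :^: [set: GL2], G \subset C]
      && [exists g in G, #[g] == #|F|]]|
    = #|subgroups diag_GL2|.
Proof.
move=> pF; apply: (card_classes_order_p pF upper_GL2_sdprod card_unipotent).
- rewrite /pgroup card_diag_GL2 p'natE // Euclid_dvdX // andbT.
  by rewrite gtnNdvd // ?prednK ?ltn_predRL ?prime_gt1 ?prime_gt0.
- exact: abelian_diag_GL2.
exact: norm_unipotent.
Qed.

End Triangular.

(** * The group {'GL_2[F]} *)

(** The next two lemmas transfer the counts from {unit 'M[F]_2} to {'GL_2[F]} by
    conversion. This is done over an abstract field, since over 'F_l the
    conversion would also unfold modular arithmetic. *)
Lemma card_subgroups_GL2_torus (F : finFieldType) :
  #|subgroups [set g : {'GL_2[F]} | is_diag_mx (GLval g)]| = alpha #|F|.-1.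
Proof. exact (card_subgroups_diag_GL2 F). Qed.

Lemma card_GL2_Borel_classes (F : finFieldType) : prime #|F| ->
  #|conjugacy_classes [set G : {group {'GL_2[F]}} |
      [exists C in [set g : {'GL_2[F]} | is_trig_mx (GLval g)^T%R] :^: 'GL_2[F],
         G \subset C]
      && [exists g in G, #[g] == #|F|]]|
    = alpha #|F|.-1.
Proof.
move=> pF; rewrite -card_subgroups_diag_GL2.
exact (card_upper_GL2_classes pF).
Qed.

Theorem corollary3p5 (l : nat) (l_prime : prime l) (l_odd : odd l) :
  #|conjugacy_classes (borel_subgroups_with_elt_order l)| = alpha l.-1 /\
  alpha l.-1 = #|subgroups (Cs l)|.
Proof.
have cardF := card_Fp l_prime.
have := @card_GL2_Borel_classes 'F_l; have := card_subgroups_GL2_torus 'F_l.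
rewrite cardF => cardT /(_ l_prime) cardC.
split; first exact cardC.
exact (esym cardT).
Qed.
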